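(* For any integer $n \geq 0$ (with $a$ denoting a nonnegative integer), $$v_2(B_n(4,2)) = \begin{cases} 1+v_2(a), & \text{if } n=5a \text{ and } v_2(a) \leq 5, \\ 1+ v_2 \big( a(a+1) \big), & \text{if } n = 5a+1 \text{ and } v_2 \big( a(a+1) \big) \leq 5, \\ 0, & \text{if } n \equiv 2 \pmod{5}, \\ 1 + v_2(a), & \text{if } n=5a+3 \text{ and } v_2(a) \leq 4, \\ 0, & \text{if } n \equiv 4 \pmod{5}. \end{cases}$$ (No assertion is made for values of $n$ not covered by these cases.)
   Context: The sequence $\{B_n(4,2)\}_{n\geq 0}$ is defined by $B_n = B_{n-1}+B_{n-2}+B_{n-3}+B_{n-4}$ for $n \geq 4$, with $(B_0,B_1,B_2,B_3)=(0,0,1,0)$. $v_2$ denotes the 2-adic order (2-adic valuation), with the convention $v_2(0)=+\infty$. *)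

(* Defs.v *)
From HB Require Import structures.
From mathcomp Require Import all_boot all_order all_algebra.
From mathcomp Require Import constructive_ereal.
Set Implicit Arguments. Unset Strict Implicit. Unset Printing Implicit Defensive.
Local Open Scope nat_scope.

(* The generalized tetranacci sequence B_n(4,2). *)
Fixpoint B42 (n : nat) : nat :=
  match n with
  | 0 => 0
  | 1 => 0
  | 2 => 1
  | 3 => 0
  | (((m0.+1 as m1).+1 as m2).+1 as m3).+1 => B42 m3 + B42 m2 + B42 m1 + B42 m0
  end.

(* The 2-adic order; note that [logn 2 0] is 0, not +oo. *)
Definition v2 (m : nat) : \bar int :=
  if m == 0 then +oo%E else ((logn 2 m)%:Z)%:E.

(* Main.v *)
Require Import Defs.
From HB Require Import structures.
From mathcomp Require Import all_boot all_order all_algebra.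
From mathcomp Require Import constructive_ereal.
Set Implicit Arguments. Unset Strict Implicit. Unset Printing Implicit Defensive.
Local Open Scope nat_scope.

(** Modulo 128 the sequence is periodic with period [320 = 5 * 64], so
[gcdn (B42 (5 * a + c)) 128] depends only on [a] modulo 64 and can be
tabulated. This gcd determines the 2-adic order as long as that order is at
most 6, which is what the bounds in the theorem guarantee. *)

Definition tetra_step (s : nat * nat * nat * nat) : nat * nat * nat * nat :=
  let: (x, y, z, t) := s in (y, z, t, (x + y + z + t) %% 128).

(** A sliding window of four consecutive residues: each new term costs one step, whereas unfolding
    [B42] branches four ways and builds huge unary numbers. *)
Definition tetra_state (n : nat) : nat * nat * nat * nat :=
  iter n tetra_step (0, 0, 1, 0).

Definition tetra_residue (n : nat) : nat := (tetra_state n).1.1.1.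

Lemma tetra_stateE n :
  tetra_state n = (B42 n %% 128, B42 n.+1 %% 128,
                   B42 n.+2 %% 128, B42 n.+3 %% 128).
Proof.
elim: n => [//|n IHn]; rewrite /tetra_state iterS -/(tetra_state n) IHn.
have -> : B42 n.+4 = B42 n.+3 + B42 n.+2 + B42 n.+1 + B42 n by [].
set x := B42 n; set y := B42 n.+1; set z := B42 n.+2; set t := B42 n.+3.
rewrite /tetra_step; congr (_, _, _, _).
rewrite -addnA -[LHS]modnDm (modnDm x) (modnDm z) modnDm.
by rewrite addnC (addnC z) (addnC x) addnA.
Qed.

Lemma iter_periodic (T : Type) (f : T -> T) x p n :
  iter p f x = x -> iter (n %% p) f x = iter n f x.
Proof.
move=> per; rewrite [in RHS](divn_eq n p) addnC iterD; congr iter.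
by elim: (n %/ p) => [//|q IHq]; rewrite mulSn iterD -IHq.
Qed.

(** By computation, 320 steps bring the window back to [(0, 0, 1, 0)]. *)
Lemma tetra_state_mod n : tetra_state (n %% 320) = tetra_state n.
Proof. by apply: iter_periodic; vm_compute. Qed.

Lemma B42_block a c :
  B42 (5 * a + c) %% 128 = tetra_residue (5 * (a %% 64) + c).
Proof.
rewrite /tetra_residue -[in RHS]tetra_state_mod -modnDml (_ : 320 = 5 * 64) //.
by rewrite -muln_modr modn_mod muln_modr modnDml tetra_state_mod tetra_stateE.
Qed.

(** A gcd with 128 sees only residues modulo 128, and on both sides these depend on [a] modulo 64
    alone, so 64 checks settle every [a]. *)
Lemma gcdn_block_table c (f : nat -> nat) :
    (forall a, f (a %% 64) = f a %[mod 128]) ->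
    all (fun a => gcdn (tetra_residue (5 * a + c)) 128 == gcdn (f a) 128)
        (iota 0 64) ->
  forall a, gcdn (B42 (5 * a + c)) 128 = gcdn (f a) 128.
Proof.
move=> fmod /allP table a; rewrite -gcdn_modl B42_block.
rewrite -[RHS]gcdn_modl -fmod gcdn_modl; apply/eqP/table.
by rewrite mem_iota /= ltn_pmod.
Qed.

Lemma double_mod64 a : 2 * (a %% 64) = 2 * a %[mod 128].
Proof. by rewrite muln_modr modn_mod. Qed.

Lemma gcdn_B42_0 a : gcdn (B42 (5 * a)) 128 = gcdn (2 * a) 128.
Proof.
rewrite -[5 * a]addn0; apply: (@gcdn_block_table 0 (muln 2)); first exact: double_mod64.
by vm_compute.
Qed.

Lemma gcdn_B42_1 a : gcdn (B42 (5 * a + 1)) 128 = gcdn (2 * (a * (a + 1))) 128.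
Proof.
apply: (@gcdn_block_table 1 (fun a => 2 * (a * (a + 1)))) => [b|].
  (* The factor 2 lifts a congruence modulo 64 to one modulo 128, so it is enough to compare
     [a * (a + 1)] modulo 64. *)
  rewrite -double_mod64 -[RHS]double_mod64; congr (2 * _ %% _).
  by rewrite modnMml -modnMmr modnDml modnMmr.
by vm_compute.
Qed.

Lemma gcdn_B42_2 a : gcdn (B42 (5 * a + 2)) 128 = 1.
Proof. by apply: (@gcdn_block_table 2 (fun=> 1)); last vm_compute. Qed.

Lemma gcdn_B42_3 a : gcdn (B42 (5 * a + 3)) 128 = gcdn (2 * a) 128.
Proof.
apply: (@gcdn_block_table 3 (muln 2)); first exact: double_mod64.
by vm_compute.
Qed.

Lemma gcdn_B42_4 a : gcdn (B42 (5 * a + 4)) 128 = 1.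
Proof. by apply: (@gcdn_block_table 4 (fun=> 1)); last vm_compute. Qed.

(** For positive [m] the gcd with [2 ^ k] has order [minn (logn 2 m) k]. A value below [k] is not
    truncated, so it is the order of [m]. *)
Lemma logn2_gcd_exp k m l : 0 < l -> logn 2 l < k ->
  gcdn m (2 ^ k) = gcdn l (2 ^ k) -> 0 < m /\ logn 2 m = logn 2 l.
Proof.
move=> l_gt0 lk eq_gcd; have k2_gt0 : 0 < 2 ^ k by rewrite expn_gt0.
have : logn 2 (gcdn m (2 ^ k)) = logn 2 l.
  by rewrite eq_gcd logn_gcd // pfactorK //; apply/minn_idPl/ltnW.
case: (posnP m) => [-> | m_gt0].
  (* For [m = 0] the gcd is [2 ^ k], whose order [k] is too large. *)
  by rewrite gcd0n pfactorK // => kl; rewrite kl ltnn in lk.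
rewrite logn_gcd // pfactorK // => min_eq; split=> //.
by move: min_eq lk; rewrite /minn; case: ltnP => // _ ->; rewrite ltnn.
Qed.

Lemma v2_double m l : gcdn m 128 = gcdn (2 * l) 128 ->
  (v2 l <= 5%:E)%E -> v2 m = (1 + v2 l)%E.
Proof.
(* If [l = 0], then [v2 l] is [+oo] and the bound fails. *)
case: (posnP l) => [-> //|l_gt0] eq_gcd.
rewrite /v2 (gtn_eqF l_gt0) lee_fin lez_nat => lk.
have log2l : logn 2 (2 * l) = (logn 2 l).+1 by rewrite lognM.
(* Here 128 is [2 ^ 7], and the order of [2 * l] is at most 6. *)
have [||m_gt0 log_m] := @logn2_gcd_exp 7 _ _ _ _ eq_gcd; rewrite ?muln_gt0 ?log2l //.
by rewrite (gtn_eqF m_gt0) log_m log2l.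
Qed.

Lemma v2_coprime m : gcdn m 128 = 1 -> v2 m = 0%E.
Proof.
move=> m_odd; have [|||m_gt0 log_m] := @logn2_gcd_exp 7 m 1 => //.
by rewrite /v2 (gtn_eqF m_gt0) log_m logn1.
Qed.

Theorem theorem15 (n : nat) :
  (forall a : nat, n = 5 * a -> (v2 a <= 5%:E)%E ->
     v2 (B42 n) = (1 + v2 a)%E) /\
  (forall a : nat, n = 5 * a + 1 -> (v2 (a * (a + 1)) <= 5%:E)%E ->
     v2 (B42 n) = (1 + v2 (a * (a + 1)))%E) /\
  (n = 2 %[mod 5] -> v2 (B42 n) = 0%E) /\
  (forall a : nat, n = 5 * a + 3 -> (v2 a <= 4%:E)%E ->
     v2 (B42 n) = (1 + v2 a)%E) /\
  (n = 4 %[mod 5] -> v2 (B42 n) = 0%E).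
Proof.
split=> [a -> |]; first exact/v2_double/gcdn_B42_0.
split=> [a -> |]; first exact/v2_double/gcdn_B42_1.
split=> [n2 |].
  by rewrite (divn_eq n 5) n2 mulnC; exact/v2_coprime/gcdn_B42_2.
split=> [a -> le4 | n4].
  by apply: (v2_double (gcdn_B42_3 a)); apply: Order.POrderTheory.le_trans le4 _.
by rewrite (divn_eq n 5) n4 mulnC; exact/v2_coprime/gcdn_B42_4.
Qed.
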